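(* For any $n\in[1,2]$, $x=1$ and any integer $k\ge1$, $$\mathbb{P}_{\mathsf{Tor}_k,n,1}\big(\text{there exists a non-contractible loop}\big)\ge\tfrac14 .$$
   Context: Let $\mathbb{H}$ be the hexagonal lattice, embedded in the plane so that its faces are centered at the points $a+be^{i\pi/3}$, $a,b\in\mathbb{Z}$. $\mathsf{Tor}_k$ denotes the $k\times k$ torus obtained by identifying the faces on the opposite sides of the parallelogram domain in $\mathbb{H}$ which consists of the faces $s+te^{i\pi/3}$, where $0\le s,t\le k$ are integers. A loop configuration on $\mathsf{Tor}_k$ is a spanning subgraph in which every vertex has even degree; its loops are its components that are simple cycles. The loop $O(n)$ measure on $\mathsf{Tor}_k$ with edge-weight $x$ is the probability measure on loop configurations on $\mathsf{Tor}_k$ given by $\mathbb{P}_{\mathsf{Tor}_k,n,x}(\omega)=x^{|\omega|}n^{\ell(\omega)}/Z_{\mathsf{Tor}_k,n,x}$, where $|\omega|$ is the number of edges of $\omega$, $\ell(\omega)$ is the number of loops of $\omega$, and $Z_{\mathsf{Tor}_k,n,x}$ is the normalizing constant. A loop is non-contractible if it has a non-trivial homotopy when considered as a subset of the continuous torus. *)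

(* Defs.v *)
From HB Require Import structures.
From mathcomp Require Import all_boot all_order all_algebra.
From mathcomp Require Import generic_quotient.
From mathcomp Require Import all_classical all_reals all_analysis.
Import Order.TTheory GRing.Theory Num.Theory.
Import numFieldNormedType.Exports.

Set Implicit Arguments.
Unset Strict Implicit.
Unset Printing Implicit Defensive.

Local Open Scope ring_scope.
Local Open Scope quotient_scope.

(** The faces of the hexagonal lattice are centred at the points
    [s + t e^(i pi/3)].  Its vertices are the centroids of the triangles of the
    dual triangular lattice; those contained in the rhombus with lower left
    corner [s + t e^(i pi/3)] are
      [(s, t, false)], dual to the triangle [(s, t), (s+1, t), (s, t+1)], and
      [(s, t, true)],  dual to the triangle [(s+1, t), (s, t+1), (s+1, t+1)].
    Coordinates are taken modulo [k].  The edges are indexed by their endpoint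
    of the first kind and by one of the three directions, so that the parallel
    edges present when [k = 1] are kept distinct. *)
Definition vertex (k : nat) : finType := ('I_k * 'I_k * bool)%type.
Definition edge (k : nat) : finType := ('I_k * 'I_k * 'I_3)%type.

Definition edge_src (k : nat) (e : edge k) : vertex k :=
  let: (s, t, _) := e in (s, t, false).

Definition edge_tgt (k : nat) (e : edge k) : vertex k :=
  let: (s, t, d) := e in
  match val d with
  | 0%N => (s, t, true)
  | 1%N => (s, ord_pred t, true)
  | _ => (ord_pred s, t, true)
  end.

Definition joins (k : nat) (e : edge k) (v w : vertex k) : bool :=
  ((v == edge_src e) && (w == edge_tgt e))
  || ((v == edge_tgt e) && (w == edge_src e)).

Definition incident (k : nat) (e : edge k) (v : vertex k) : bool :=
  (v == edge_src e) || (v == edge_tgt e).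

(** A spanning subgraph is identified with its set of edges. *)
Definition degree (k : nat) (w : {set edge k}) (v : vertex k) : nat :=
  #|[set e in w | incident e v]|.

Definition loop_config (k : nat) (w : {set edge k}) : bool :=
  [forall v, ~~ odd (degree w v)].

Definition adjacent (k : nat) (w : {set edge k}) : rel (vertex k) :=
  fun u v => [exists e in w, joins e u v].

Definition components (k : nat) (w : {set edge k}) : {set {set vertex k}} :=
  equivalence_partition (connect (adjacent w)) [set: vertex k].

Definition edges_in (k : nat) (w : {set edge k}) (A : {set vertex k}) :
    {set edge k} :=
  [set e in w | (edge_src e \in A) && (edge_tgt e \in A)].

Definition simple_cycle (k : nat) (A : {set vertex k}) (C : {set edge k}) :
    Prop :=
  exists m : nat, exists v : 'I_m -> vertex k, exists e : 'I_m -> edge k,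
    [/\ (0 < m)%N, injective v /\ injective e,
        A = [set v i | i : 'I_m], C = [set e i | i : 'I_m]
      & forall i : 'I_m, joins (e i) (v i) (v (ordS i))].

Definition loops (k : nat) (w : {set edge k}) : {set {set vertex k}} :=
  [set A in components w | `[< simple_cycle A (edges_in w A) >]].

Definition weight (R : realType) (k : nat) (n x : R) (w : {set edge k}) : R :=
  x ^+ #|w| * n ^+ #|loops w|.

Definition partition_function (R : realType) (k : nat) (n x : R) : R :=
  \sum_(w : {set edge k} | loop_config w) weight n x w.

Definition loopO_prob (R : realType) (k : nat) (n x : R)
    (E : {set {set edge k}}) : R :=
  \sum_(w in E | loop_config w) weight n x w / partition_function k n x.

(** [hex_point u v] is the point [u + v e^(i pi/3)] of the plane. *)
Definition hex_point (R : realType) (u v : R) : R * R :=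
  (u + v / 2, v * (Num.sqrt 3 / 2)).

Section ContinuousTorus.
Variables (R : realType) (k : nat).

Definition torus_rel (p q : R * R) : bool :=
  `[< exists a b : int, p = q + hex_point (k%:R * a%:~R) (k%:R * b%:~R) >].

Lemma torus_rel_equiv : equiv_class_of torus_rel.
Proof.
split.
- move=> p; apply/asboolP; exists 0, 0.
  by rewrite /hex_point !mulr0 !mul0r addr0; case: p => x y; congr pair; rewrite /= addr0.
- apply: symmetric_from_pre => p q /asboolP[a [b ->]]; apply/asboolP.
  exists (- a), (- b); rewrite /hex_point !rmorphN !mulrN !mulNr -opprD.
  by case: q => x y; congr pair; rewrite /= addrK.
- move=> q p r /asboolP[a [b ->]] /asboolP[c [d ->]]; apply/asboolP.
  exists (c + a), (d + b); case: r => x y.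
  rewrite /hex_point !rmorphD !mulrDr; congr pair => /=.
    by rewrite mulrDl -!addrA; congr (_ + (_ + _)); rewrite addrCA.
  by rewrite mulrDl addrA.
Qed.

Canonical torus_equiv := EquivRelPack torus_rel_equiv.

Definition torus : topologicalType :=
  quotient_topology {eq_quot torus_equiv}.

Definition torus_pi (p : R * R) : torus := \pi_{eq_quot torus_equiv} p.

End ContinuousTorus.

(** In the coordinates [u + v e^(i pi/3)], the vertex [(s, t, false)] lies at
    [(s + 1/3, t + 1/3)], and the edge in direction [d] from it is the segment
    with the following displacement vector. *)
Definition edge_vector (R : realType) (d : 'I_3) : R * R :=
  match val d with
  | 0%N => (1 / 3, 1 / 3)
  | 1%N => (1 / 3, - (2 / 3))
  | _ => (- (2 / 3), 1 / 3)
  end.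

Definition edge_segment (R : realType) (k : nat) (e : edge k) :
    set (torus R k) :=
  let: (s, t, d) := e in
  [set z | exists2 l : R, 0 <= l <= 1 &
     z = torus_pi k (hex_point ((val s)%:R + 1 / 3 + l * (edge_vector R d).1)
                               ((val t)%:R + 1 / 3 + l * (edge_vector R d).2))
  ]%classic.

Definition drawing (R : realType) (k : nat) (C : {set edge k}) :
    set (torus R k) :=
  [set z | exists2 e, e \in C & edge_segment e z]%classic.

(** The inclusion of [S] into [T] is homotopic to a constant map. *)
Definition contractible_in (R : realType) (T : topologicalType) (S : set T) :
    Prop :=
  exists H : R * T -> T,
    [/\ {within `[0, 1] `*` S, continuous H}%classic,
        forall z, S z -> H (0, z) = z
      & exists c, forall z, S z -> H (1, z) = c].

Definition has_noncontractible_loop (R : realType) (k : nat)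
    (w : {set edge k}) : Prop :=
  exists2 A, A \in loops w & ~ contractible_in R (drawing (R := R) (edges_in w A)).

(* Main.v *)
Require Import Defs.
From mathcomp Require Import all_boot all_order all_algebra.
From mathcomp Require Import all_classical all_reals all_analysis.
From mathcomp Require Import ring lra zify.
Import Defs.
Import Order.TTheory GRing.Theory Num.Theory.
Import numFieldNormedType.Exports.
Set Implicit Arguments.
Unset Strict Implicit.
Unset Printing Implicit Defensive.
Local Open Scope ring_scope.

(** Homology modulo 2 suffices. Cut the torus along two seams, and call a set of
    edges [nontrivial] when it crosses one of the seams an odd number of times.
    Since vertices have degree three, the components of a configuration that
    contain an edge are simple cycles ([component_simple_cycle]), so a nontrivial
    configuration has a loop that crosses a seam an odd number of times, and
    such a loop cannot be contracted ([contractible_seam0]).  It is therefore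
    enough to show that nontrivial configurations have probability at least
    one quarter.

    Write [n = 1 + q] and expand the loop weight: every loop is either coloured,
    with weight [q], or plain, with weight [1].  As [x = 1], a configuration with
    a set [S] of coloured loops has weight [q ^+ #|S|], which depends on [S] only.
    Hence an even subgraph that avoids the coloured loops may be added modulo 2
    to the configuration without changing the weight.  If that subgraph is
    nontrivial, the operation turns trivial configurations into nontrivial ones,
    and it is injective as soon as the subgraph is a function of the coloured
    edges ([resampling_le]).

    Such a nontrivial subgraph exists for at least half of the colourings, by a
    duality argument ([avoidable_dual]).  Suppose that for two disjoint sets
    of loops every even subgraph avoiding the first set, and every even subgraph
    avoiding the second one, is trivial.  A cochain that vanishes on the even
    subgraphs of a graph is a coboundary there, so both seams can be moved within
    their cohomology class, the first onto the edges of the first set of loops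
    and the second onto those of the second set.  The two seams meet once and the
    intersection number is a cohomology invariant, so the moved seams intersect.
    But around a hexagon two even families of edges which share no vertex cannot
    interleave, for lack of room, so the moved seams do not intersect.  Since
    [q <= 1], complementing the colouring then shows that the favourable ones
    carry half of the total weight ([colouring_half]).

    With [Z] the partition function and [N] the weight of the nontrivial
    configurations, the favourable pairs weigh at least [Z / 2]; those with a
    nontrivial configuration weigh at most [N], and so do the others by the
    injection above.  Thus [Z / 2 <= 2 N].

    A contraction of a loop is treated by hand: a fine grid on the unit square
    cuts the homotopy of each edge into pieces along which a circle-valued
    coordinate of the torus moves by less than a quarter turn, so that its
    displacements add up without ambiguity.  This exhibits the displacement along
    the edges of the loop as the difference of a real function of the endpoints,
    which is impossible if the loop winds. *)

(** * Cochains modulo 2 and the intersection form *)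

(** Cup product of two cochains on a hexagon whose boundary is read from a base
    vertex: an edge of the first cochain is paired with the later edges of the
    second one. When both cochains are even and share no edge, this is the parity
    of the number of crossings inside the hexagon. *)
Definition chain_cup (x0 x1 x2 x3 x4 x5 y0 y1 y2 y3 y4 y5 : bool) : bool :=
  x0 * (y1 + y2 + y3 + y4 + y5) + x1 * (y2 + y3 + y4 + y5)
  + x2 * (y3 + y4 + y5) + x3 * (y4 + y5) + x4 * y5.

(** The part of a coboundary read before an edge telescopes to the base vertex
    and the first endpoint of this edge; the base vertex drops out because
    the other cochain is even. *)
Lemma chain_cup_coboundaryl (v0 v1 v2 v3 v4 v5 y0 y1 y2 y3 y4 y5 : bool) :
  y0 + y1 + y2 + y3 + y4 + y5 = 0 ->
  chain_cup (v0 + v1) (v1 + v2) (v2 + v3) (v3 + v4) (v4 + v5) (v5 + v0)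
    y0 y1 y2 y3 y4 y5
  = y0 * v0 + y1 * v1 + y2 * v2 + y3 * v3 + y4 * v4 + y5 * v5.
Proof.
case: y0; case: y1; case: y2; case: y3; case: y4; case: y5 => // _;
by case: v0; case: v1; case: v2; case: v3; case: v4; case: v5.
Qed.

Lemma chain_cup_coboundaryr (v0 v1 v2 v3 v4 v5 y0 y1 y2 y3 y4 y5 : bool) :
  y0 + y1 + y2 + y3 + y4 + y5 = 0 ->
  chain_cup y0 y1 y2 y3 y4 y5
     (v0 + v1) (v1 + v2) (v2 + v3) (v3 + v4) (v4 + v5) (v5 + v0)
  = y0 * v1 + y1 * v2 + y2 * v3 + y3 * v4 + y4 * v5 + y5 * v0.
Proof.
case: y0; case: y1; case: y2; case: y3; case: y4; case: y5 => // _;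
by case: v0; case: v1; case: v2; case: v3; case: v4; case: v5.
Qed.

(** Two crossing even families need two edges each, in alternating order, and an
    empty edge between any two consecutive ones: eight edges, and a hexagon has six. *)
Lemma chain_cup_separated (x0 x1 x2 x3 x4 x5 y0 y1 y2 y3 y4 y5 : bool) :
  x0 + x1 + x2 + x3 + x4 + x5 = 0 -> y0 + y1 + y2 + y3 + y4 + y5 = 0 ->
  [&& x0 ==> ~~ y0, x1 ==> ~~ y1, x2 ==> ~~ y2, x3 ==> ~~ y3, x4 ==> ~~ y4
    & x5 ==> ~~ y5] ->
  [&& x0 ==> ~~ y1, x1 ==> ~~ y2, x2 ==> ~~ y3, x3 ==> ~~ y4, x4 ==> ~~ y5
    & x5 ==> ~~ y0] ->
  [&& y0 ==> ~~ x1, y1 ==> ~~ x2, y2 ==> ~~ x3, y3 ==> ~~ x4, y4 ==> ~~ x5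
    & y5 ==> ~~ x0] ->
  chain_cup x0 x1 x2 x3 x4 x5 y0 y1 y2 y3 y4 y5 = 0.
Proof.
case: x0; case: x1; case: x2; case: x3; case: x4; case: x5 => // _;
by case: y0; case: y1; case: y2; case: y3; case: y4; case: y5.
Qed.

Section Cohomology.
Variable k : nat.
Implicit Types (C D w : {set edge k}) (e : edge k) (v : vertex k).

Lemma edge_src_false e : (edge_src e).2 = false.
Proof. by case: e => [[s t] d]. Qed.

Lemma edge_tgt_true e : (edge_tgt e).2 = true.
Proof. by case: e => [[s t] [[|[|[|m]]] h]]. Qed.

Lemma edge_src_neq_tgt e : edge_src e != edge_tgt e.
Proof. by apply/eqP => /(congr1 snd); rewrite edge_src_false edge_tgt_true. Qed.

Definition coboundary (f : vertex k -> bool) e : bool :=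
  f (edge_src e) + f (edge_tgt e).

Lemma natr_bool (n : nat) : n%:R = odd n :> bool.
Proof. by elim: n => //= n IHn; rewrite -natr1 IHn addrC. Qed.

Lemma coboundary_sum_incident f e :
  coboundary f e = \sum_(v | incident e v) f v.
Proof.
rewrite (bigD1 (edge_src e)) ?/incident ?eqxx //=; congr (_ + _).
rewrite (big_pred1 (edge_tgt e)) // => v /=.
by case: eqP => [->|_] /=; rewrite ?andbT // (negbTE (edge_src_neq_tgt e)).
Qed.

(** Handshake argument: [f v] is counted once for each edge of [C] at [v]. *)
Lemma even_sum_coboundary C f :
  loop_config C -> \sum_(e in C) coboundary f e = 0.
Proof.
move=> /forallP evenC.
under eq_bigr => e _ do rewrite coboundary_sum_incident.
rewrite (exchange_big_dep xpredT) //= big1 // => v _.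
have -> : \sum_(e in C | incident e v) f v = f v * (degree C v)%:R.
  rewrite /degree -sum1_card natr_sum mulr_sumr.
  by apply: eq_big => [e|e _]; rewrite ?inE ?mulr1.
by rewrite natr_bool (negbTE (evenC v)) mulr0.
Qed.

(** This is the duality of linear algebra over the field with two elements: the
    columns of the cokernel of the incidence matrix of [G] are even subgraphs, so
    [h] is orthogonal to them and lies in the row space of that matrix. *)
Lemma even_orthogonal_coboundary (G : {set edge k}) (h : edge k -> bool) :
  (forall C, C \subset G -> loop_config C -> \sum_(e in C) h e = 0) ->
  exists f : vertex k -> bool, forall e, e \in G -> h e = coboundary f e.
Proof.
move=> h_even.
pose M := \matrix_(i < #|{: vertex k}|, j < #|{: edge k}|)
   ((enum_val j \in G) && incident (enum_val j) (enum_val i) : bool).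
pose hG := \row_(j < #|{: edge k}|) ((enum_val j \in G) && h (enum_val j)).
have /submxP[D hD] : (hG <= M)%MS.
  rewrite submxE; move: (cokermx M) (mulmx_coker M) => N MN0.
  apply/eqP/matrixP => i j; rewrite !mxE.
  pose C := [set e in G | N (enum_rank e) j].
  rewrite -[RHS](h_even C); last first.
  - apply/forallP => v; have /matrixP/(_ (enum_rank v) j) := MN0.
    rewrite !mxE => sum0; suff -> : odd (degree C v) = 0 by [].
    rewrite -natr_bool -[RHS]sum0 /degree -sum1_card natr_sum.
    rewrite [X in _ = X](reindex (@enum_rank (edge k))) /=;
      last exact/onW_bij/enum_rank_bij.
    rewrite big_mkcond /=; apply: eq_bigr => l _.
    rewrite !inE !mxE !enum_rankK.
    by case: (l \in G); case: (incident l v); case: (N _ _).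
  - by apply/fintype.subsetP => e; rewrite inE => /andP[].
  rewrite [X in _ = X]big_mkcond /=.
  rewrite [X in X = _](reindex (@enum_rank (edge k))) /=; last exact/onW_bij/enum_rank_bij.
  apply: eq_bigr => l _; rewrite !inE !mxE !enum_rankK.
  by case: (l \in G); case: (h l); case: (N _ _).
exists (fun v => D ord0 (enum_rank v)) => e eG.
have /matrixP/(_ ord0 (enum_rank e)) := hD; rewrite !mxE enum_rankK eG /= => ->.
rewrite coboundary_sum_incident [X in _ = X]big_mkcond.
rewrite [X in X = _](reindex (@enum_rank (vertex k))) /=; last exact/onW_bij/enum_rank_bij.
apply: eq_bigr => l _; rewrite !mxE !enum_rankK eG /=.
by case: (incident e l); case: (D _ _).
Qed.

(** The six edges are those around the face [(s, t)], in counterclockwise order;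
    for [k = 1] each edge is met twice. *)
Definition cocycle (h : edge k -> bool) : Prop := forall s t : 'I_k,
   h (s, t, 2%:R) + h (ord_pred s, t, 0) + h (ord_pred s, t, 1)
 + h (s, ord_pred t, 2%:R) + h (s, ord_pred t, 0) + h (s, t, 1) = 0.

Definition face_cup (c c' : edge k -> bool) (p : 'I_k * 'I_k) : bool :=
  let: (s, t) := p in
  let e0 := (s, t, 2%:R) in let e1 := (ord_pred s, t, 0) in
  let e2 := (ord_pred s, t, 1) in let e3 := (s, ord_pred t, 2%:R) in
  let e4 := (s, ord_pred t, 0) in let e5 := (s, t, 1) in
  chain_cup (c e0) (c e1) (c e2) (c e3) (c e4) (c e5)
    (c' e0) (c' e1) (c' e2) (c' e3) (c' e4) (c' e5).

(** The face terms alone are not invariant under coboundaries; the sum over the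
    edges compensates for this, see [intersection_addl]. *)
Definition intersection (c c' : edge k -> bool) : bool :=
  \sum_p face_cup c c' p + \sum_e c e * c' e.

Lemma coboundary_cocycle f : cocycle (coboundary f).
Proof.
move=> s t; rewrite /coboundary /=; do !case: (f _) => //.
Qed.

Lemma sum_edge (F : edge k -> bool) :
  \sum_e F e = \sum_(p : 'I_k * 'I_k) (F (p, 0) + F (p, 1) + F (p, 2%:R)).
Proof.
rewrite (eq_bigr (fun e => F (e.1, e.2))); last by case.
rewrite -(pair_bigA _ (fun p d => F (p, d))) /=; apply: eq_bigr => p _.
rewrite !big_ord_recl big_ord0 addr0 addrA.
by congr (F (p, _) + F (p, _) + F (p, _)); apply: val_inj.
Qed.

Lemma sum_pred_fst (F : 'I_k * 'I_k -> bool) :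
  \sum_p F (ord_pred p.1, p.2) = \sum_p F p.
Proof.
rewrite [in X in _ = X](reindex (fun p : 'I_k * 'I_k => (ord_pred p.1, p.2))) //.
by exists (fun p => (ordS p.1, p.2)) => -[s t] _ /=; rewrite ?ord_predK ?ordSK.
Qed.

Lemma sum_pred_snd (F : 'I_k * 'I_k -> bool) :
  \sum_p F (p.1, ord_pred p.2) = \sum_p F p.
Proof.
rewrite [in X in _ = X](reindex (fun p : 'I_k * 'I_k => (p.1, ord_pred p.2))) //.
by exists (fun p => (p.1, ordS p.2)) => -[s t] _ /=; rewrite ?ord_predK ?ordSK.
Qed.

(** Changing [c] by the coboundary of [f] adds to each face, for every edge of
    [c'], the value of [f] at the endpoint from which the face runs through this
    edge. The two faces at an edge run through it in opposite directions, so
    together they add both endpoints, and this is what the sum over the edges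
    cancels. *)
Lemma intersection_addl f c c' : cocycle c' ->
  intersection (fun e => c e + coboundary f e) c' = intersection c c'.
Proof.
move=> cocycle_c'; rewrite /intersection.
have faceD p : face_cup (fun e => c e + coboundary f e) c' p =
   face_cup c c' p + face_cup (coboundary f) c' p.
  by case: p => s t; rewrite /face_cup /chain_cup /=; ring.
rewrite (eq_bigr _ (fun p _ => faceD p)) big_split -addrA; congr (_ + _).
under [X in _ + X]eq_bigr => e _ do rewrite mulrDl.
rewrite big_split /= addrCA -[X in _ = X]addr0; congr (_ + _).
pose F e := c' e * f (edge_src e); pose G e := c' e * f (edge_tgt e).
rewrite (eq_bigr (fun p : 'I_k * 'I_k => F (p, 2%:R) + G (ord_pred p.1, p.2, 0)
   + F (ord_pred p.1, p.2, 1) + G (p.1, ord_pred p.2, 2%:R)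
   + F (p.1, ord_pred p.2, 0) + G (p, 1))); last first.
  move=> [s t] _; have := cocycle_c' s t.
  move/(chain_cup_coboundaryl (f (s, t, false)) (f (ord_pred s, t, true))
    (f (ord_pred s, t, false)) (f (ord_pred s, ord_pred t, true))
    (f (s, ord_pred t, false)) (f (s, ord_pred t, true))).
  rewrite /F /G /= => <-.
  by rewrite /face_cup /coboundary /=; congr chain_cup => //; apply: addrC.
rewrite !big_split /=.
rewrite (sum_pred_fst (fun p => G (p, 0))) (sum_pred_fst (fun p => F (p, 1))).
rewrite (sum_pred_snd (fun p => G (p, 2%:R))) (sum_pred_snd (fun p => F (p, 0))).
rewrite -!big_split /= sum_edge -big_split big1 //= => p _.
rewrite /coboundary /F /G; case: p => s t /=.
move: (c' _) (c' _) (c' _) (f _) (f _) (f _) (f _) => x y z a b c0 d.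
by case: x; case: y; case: z; case: a; case: b; case: c0; case: d.
Qed.

Lemma intersection_addr f c c' : cocycle c ->
  intersection c (fun e => c' e + coboundary f e) = intersection c c'.
Proof.
move=> cocycle_c; rewrite /intersection.
have faceD p : face_cup c (fun e => c' e + coboundary f e) p =
   face_cup c c' p + face_cup c (coboundary f) p.
  by case: p => s t; rewrite /face_cup /chain_cup /=; ring.
rewrite (eq_bigr _ (fun p _ => faceD p)) big_split -addrA; congr (_ + _).
under [X in _ + X]eq_bigr => e _ do rewrite mulrDr.
rewrite big_split /= addrCA -[X in _ = X]addr0; congr (_ + _).
pose F e := c e * f (edge_src e); pose G e := c e * f (edge_tgt e).
rewrite (eq_bigr (fun p : 'I_k * 'I_k => G (p, 2%:R) + F (ord_pred p.1, p.2, 0)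
   + G (ord_pred p.1, p.2, 1) + F (p.1, ord_pred p.2, 2%:R)
   + G (p.1, ord_pred p.2, 0) + F (p, 1))); last first.
  move=> [s t] _; have := cocycle_c s t.
  move/(chain_cup_coboundaryr (f (s, t, false)) (f (ord_pred s, t, true))
    (f (ord_pred s, t, false)) (f (ord_pred s, ord_pred t, true))
    (f (s, ord_pred t, false)) (f (s, ord_pred t, true))).
  rewrite /F /G /= => <-.
  by rewrite /face_cup /coboundary /=; congr chain_cup => //; apply: addrC.
rewrite !big_split /=.
rewrite (sum_pred_fst (fun p => F (p, 0))) (sum_pred_fst (fun p => G (p, 1))).
rewrite (sum_pred_snd (fun p => F (p, 2%:R))) (sum_pred_snd (fun p => G (p, 0))).
rewrite -!big_split /= sum_edge -big_split big1 //= => p _.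
rewrite /coboundary /F /G; case: p => s t /=.
move: (c _) (c _) (c _) (f _) (f _) (f _) (f _) => x y z a b c0 d.
by case: x; case: y; case: z; case: a; case: b; case: c0; case: d.
Qed.

(** The edges across which a coordinate jumps: [seam true] concerns the first
    coordinate, [seam false] the second one. *)
Definition seam (i : bool) (e : edge k) : bool :=
  let: (s, t, d) := e in
  if i then (val s == 0)%N && (val d == 2)%N else (val t == 0)%N && (val d == 1)%N.

Lemma seam_cocycle i : cocycle (seam i).
Proof.
by move=> s t; rewrite /seam /=; case: i; rewrite ?andbF ?andbT;
  case: (_ == 0)%N.
Qed.

(** The two seams meet in the face [(0, 0)] only. *)
Lemma intersection_seam : (0 < k)%N -> intersection (seam true) (seam false) = 1.
Proof.
move=> k_gt0; rewrite /intersection [X in _ + X]big1 ?addr0; last first.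
  move=> [[s t] d] _ /=.
  by case: d => -[|[|[|]]] //= ?; rewrite ?andbF ?mulr0 ?mul0r.
pose o := Ordinal k_gt0.
rewrite (eq_bigr (fun p => (p == (o, o)) : bool)).
  by rewrite (bigD1 (o, o)) //= eqxx big1 // => p /negbTE.
move=> [s t] _; rewrite /face_cup /seam /=.
rewrite [RHS]xpair_eqE -!val_eqE /= !andbF !andbT.
by case: (_ == 0)%N; case: (_ == 0)%N.
Qed.

Lemma intersection_separated c c' :
  cocycle c -> cocycle c' ->
  (forall e e' v, c e -> c' e' -> incident e v -> incident e' v -> False) ->
  intersection c c' = 0.
Proof.
move=> cocycle_c cocycle_c' sep; rewrite /intersection !big1 //.
  move=> e _; case ce: (c e); case c'e: (c' e) => //.
  by case: (sep e e (edge_src e)); rewrite // /incident eqxx.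
have sep_src e e' : incident e' (edge_src e) -> c e ==> ~~ c' e'.
  move=> inc; apply/implyP => ce; apply/negP => c'e.
  by apply: (sep _ _ _ ce c'e _ inc); rewrite /incident eqxx.
have sep_tgt e e' : incident e' (edge_tgt e) -> c e ==> ~~ c' e'.
  move=> inc; apply/implyP => ce; apply/negP => c'e.
  by apply: (sep _ _ _ ce c'e _ inc); rewrite /incident eqxx orbT.
have sep_src' e e' : incident e' (edge_src e) -> c' e ==> ~~ c e'.
  move=> inc; apply/implyP => ce; apply/negP => c'e.
  by apply: (sep _ _ _ c'e ce inc); rewrite /incident eqxx.
have sep_tgt' e e' : incident e' (edge_tgt e) -> c' e ==> ~~ c e'.
  move=> inc; apply/implyP => ce; apply/negP => c'e.
  by apply: (sep _ _ _ c'e ce inc); rewrite /incident eqxx orbT.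
move=> [s t] _; apply: chain_cup_separated; [exact: cocycle_c|exact: cocycle_c'|..].
all: apply/and5P; split; last (apply/andP; split).
all: first [ by apply: sep_src; rewrite /incident /= eqxx ?orbT
           | by apply: sep_tgt; rewrite /incident /= eqxx ?orbT
           | by apply: sep_src'; rewrite /incident /= eqxx ?orbT
           | by apply: sep_tgt'; rewrite /incident /= eqxx ?orbT ].
Qed.

End Cohomology.

(** * Components of even subgraphs *)

Section Components.
Variable k : nat.
Implicit Types (w C : {set edge k}) (e : edge k) (u v : vertex k).
Implicit Types (A : {set vertex k}).

Lemma joinsC e u v : joins e u v = joins e v u.
Proof. by rewrite /joins orbC [X in X || _]andbC [X in _ || X]andbC. Qed.

Lemma joins_src_tgt e : joins e (edge_src e) (edge_tgt e).
Proof. by rewrite /joins !eqxx. Qed.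

Lemma joins_incident e u v : joins e u v -> incident e u.
Proof. by rewrite /incident => /orP[] /andP[-> _]; rewrite ?orbT. Qed.

Lemma joins_inj e u v u' v' : joins e u v -> joins e u' v' ->
  (u = u' /\ v = v') \/ (u = v' /\ v = u').
Proof.
by move=> /orP[] /andP[/eqP-> /eqP->] /orP[] /andP[/eqP-> /eqP->]; [left|right|right|left].
Qed.

Lemma adjacent_sym w : symmetric (adjacent w).
Proof. by move=> u v; apply: eq_existsb => e; rewrite joinsC. Qed.

Lemma connect_adjacent_sym w : connect_sym (adjacent w).
Proof. exact/sym_connect_sym/adjacent_sym. Qed.

Lemma joins_adjacent w e u v : e \in w -> joins e u v -> adjacent w u v.
Proof. by move=> ew euv; apply/existsP; exists e; rewrite ew. Qed.

Lemma componentsP w A :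
  reflect (exists x, A = [set y | connect (adjacent w) x y]) (A \in components w).
Proof.
apply: (iffP imsetP) => [[x _ ->]|[x ->]]; exists x => //;
  by apply/setP => y; rewrite !inE.
Qed.

Lemma component_connect w A x y : A \in components w -> x \in A ->
  (y \in A) = connect (adjacent w) x y.
Proof.
move=> /componentsP[z ->]; rewrite !inE => zx.
by rewrite (same_connect (connect_adjacent_sym w) zx).
Qed.

Lemma edges_in_component w A e v : A \in components w -> v \in A ->
  incident e v -> (e \in edges_in w A) = (e \in w).
Proof.
move=> Ac vA ev; rewrite !inE; case: (boolP (e \in w)) => //= ew.
have st : connect (adjacent w) (edge_src e) (edge_tgt e).
  by apply/connect1/(joins_adjacent ew)/joins_src_tgt.
have [/eqP vE|/eqP vE] := orP ev; rewrite vE in vA; rewrite vA.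
  by rewrite (component_connect _ Ac vA).
by rewrite (component_connect _ Ac vA) connect_adjacent_sym st.
Qed.

(** The direction of an edge and one of its endpoints determine the edge. *)
Lemma incident_le3 v : (#|[set e : edge k | incident e v]| <= 3)%N.
Proof.
rewrite -[X in (_ <= X)%N]card_ord.
apply: (@leq_card_in _ _ snd) => -[[s t] d] [[s' t'] d']; rewrite !inE => + + /= E.
rewrite -{}E {d'} /incident; case: v => [[a b] c].
have predI := can_inj (@ord_predK k).
case: d => [[|[|[|d]]] hd] //=; rewrite !xpair_eqE; case: c;
  rewrite ?andbF ?andbT ?orbF /= => /andP[/eqP-> /eqP->] /andP[/eqP Es /eqP Et].
all: try move/predI: Es => Es; try move/predI: Et => Et; by rewrite Es Et.
Qed.

Lemma even_degree_le2 w v : loop_config w -> (degree w v <= 2)%N.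
Proof.
move=> /forallP/(_ v); have : (degree w v <= 3)%N.
  apply: leq_trans (incident_le3 v); apply: subset_leq_card.
  by apply/fintype.subsetP => e; rewrite !inE => /andP[].
by case: (degree w v) => [|[|[|[|n]]]].
Qed.

(** An edge of an even subgraph is not a bridge: otherwise the indicator of one
    side of the bridge has a coboundary supported on this edge alone, against
    [even_sum_coboundary]. *)
Lemma connect_remove_edge w e0 : loop_config w -> e0 \in w ->
  connect (adjacent (w :\ e0)) (edge_tgt e0) (edge_src e0).
Proof.
move=> evenw e0w; apply/negPn/negP => nconn.
pose f v := connect (adjacent (w :\ e0)) (edge_tgt e0) v.
have := even_sum_coboundary f evenw.
rewrite (bigD1 e0) //= big1 => [|e /andP[ew ne]].
  by rewrite /coboundary /f connect0 (negbTE nconn).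
have ew' : e \in w :\ e0 by rewrite !inE ne.
rewrite /coboundary /f.
have st := connect1 (joins_adjacent ew' (joins_src_tgt e)).
rewrite -(same_connect_r (connect_adjacent_sym _) st).
exact: addbb.
Qed.

(** Closing a simple path that joins the ends of [e0] outside [e0] gives a cycle.
    Degrees are at most two, so the cycle uses all the edges at its
    vertices, and therefore fills its component. *)
Lemma component_simple_cycle w A e0 :
  loop_config w -> A \in components w -> e0 \in edges_in w A ->
  simple_cycle A (edges_in w A).
Proof.
move=> evenw Ac; rewrite inE => /andP[e0w /andP[srcA tgtA]].
set b := edge_tgt e0 in tgtA *; set a := edge_src e0 in srcA *.
have /connectP[p0] : connect (adjacent (w :\ e0)) b a by exact: connect_remove_edge.
case/shortenP => p pathp uniqp _ lastp {p0}.
have p_gt0 : (0 < size p)%N.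
  case: p lastp {pathp uniqp} => //= ab; have := edge_src_neq_tgt e0.
  by rewrite -/a -/b ab eqxx.
pose m := (size p).+1; pose v (i : 'I_m) := nth b (b :: p) i.
have v_inj : injective v.
  by move=> i j /eqP; rewrite nth_uniq // => /eqP/val_inj.
have eP i : exists e, [/\ e \in w, joins e (v i) (v (ordS i))
    & (e == e0) = (val i == size p)].
  have [ip|] := ltnP i (size p).
    have /existsP[e /andP[/setD1P[ne ew] ej]] := pathP b pathp i ip.
    exists e; split=> //; last by rewrite (negbTE ne) (ltn_eqF ip).
    by move: ej; rewrite /v /= modn_small.
  move=> ip; have {ip} iE : val i = size p.
    by apply/eqP; rewrite eqn_leq ip -ltnS ltn_ord.
  exists e0; split; rewrite ?e0w ?iE ?eqxx //.
  rewrite /v /= iE modnn /=.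
  have -> : nth b (b :: p) (size p) = a by rewrite lastp (last_nth b).
  exact: joins_src_tgt.
have [c cP] := fin_all_exists eP.
have cw i : c i \in w by have [] := cP i.
have cj i : joins (c i) (v i) (v (ordS i)) by have [] := cP i.
have c_inj : injective c.
  move=> i j cij; have [_ _ ci0] := cP i; have [_ _ cj0] := cP j.
  have [] := joins_inj (cj i) (eq_ind_r (fun e => joins e _ _) (cj j) cij).
    by case=> /v_inj.
  case=> /v_inj iE /v_inj jE; apply: val_inj.
  have [im|im] := eqVneq (val i) (size p).
    by move: cj0; rewrite -cij ci0 im eqxx => /esym/eqP.
  have jm : val j != size p by rewrite -cj0 -cij ci0.
  have := congr1 val iE; have := congr1 val jE; rewrite /= !modn_small ?ltnS; last 2 first.
  - by rewrite ltn_neqAle jm -ltnS ltn_ord.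
  - by rewrite ltn_neqAle im -ltnS ltn_ord.
  by lia.
(* The two cycle edges at a vertex exhaust its degree. *)
have cycle_edges e i : e \in w -> incident e (v i) -> exists j, e = c j.
  move=> ew ev.
  have sub2 : [set c i; c (ord_pred i)] \subset [set e in w | incident e (v i)].
    apply/fintype.subsetP => e'; rewrite !inE => /orP[] /eqP ->; rewrite cw /=.
      exact: joins_incident (cj i).
    by have := cj (ord_pred i); rewrite ord_predK joinsC => /joins_incident.
  have ne : c i != c (ord_pred i).
    apply/eqP => /c_inj /(congr1 (@ordS m)); rewrite ord_predK => /(congr1 val) /= iE.
    have := ltn_ord i; rewrite -/m.
    have [im|im] := eqVneq (val i) (size p).
      by move: iE; rewrite im modnn => sp; rewrite -sp in p_gt0.
    move: iE; rewrite modn_small; last by rewrite ltnS ltn_neqAle im -ltnS ltn_ord.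
    by move/eqP; rewrite eqn_leq ltnn.
  have /eqP E : [set c i; c (ord_pred i)] == [set e in w | incident e (v i)].
    by rewrite eqEcard sub2 cards2 ne; exact: even_degree_le2.
  have : e \in [set e in w | incident e (v i)] by rewrite inE ew.
  by rewrite -E !inE => /orP[] /eqP ->; eexists.
(* Hence a walk that starts on the cycle never leaves it. *)
have stay q u i : u = v i -> path (adjacent w) u q -> exists j, last u q = v j.
  elim: q u i => [|u' q IHq] u i uE /=; first by exists i.
  case/andP => /existsP[e /andP[ew euu']] pathq.
  have [|j eE] := cycle_edges e i ew; first by rewrite -uE (joins_incident euu').
  rewrite eE in euu'; have := joins_inj euu' (cj j).
  by case=> -[_ u'E]; exact: IHq u'E pathq.
have AE : A = [set v i | i : 'I_m].
  apply/setP => y; rewrite (component_connect _ Ac tgtA).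
  apply/idP/imsetP => [/connectP[q pathq ->]|[i _ ->]]; last first.
    apply: (path_connect (p := p)); last exact: mem_nth.
    apply: sub_path pathp => u u' /existsP[e /andP[/setD1P[_ ew]]].
    exact: joins_adjacent.
  by have [j ->] := stay q b ord0 erefl pathq; exists j.
exists m, v, c; split => //; apply/setP => e.
rewrite inE; apply/andP/imsetP => [[ew /andP[]]|[i _ ->]]; last first.
  rewrite cw AE; split=> //; have /orP[/andP[/eqP<- /eqP<-]|/andP[/eqP<- /eqP<-]] := cj i;
  by rewrite !imset_f.
rewrite AE => /imsetP[i _ srcE] _.
have [|j ->] := cycle_edges e i ew; first by rewrite -srcE /incident eqxx.
by exists j.
Qed.

End Components.

(** * Discrete winding of a grid on the circle *)

Section Winding.
Variable R : realType.
Implicit Types (x y z ctr : R) (g : nat -> nat -> R).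

(** The representative modulo 1 in the interval from [- 1 / 2] to [1 / 2]. *)
Definition wrap x : R := x - (Num.floor (x + 1 / 2))%:~R.

Lemma wrap_small (m : int) x : `|x| < 1 / 2 -> wrap (x + m%:~R) = x.
Proof.
rewrite ltr_norml => /andP[lo hi]; rewrite /wrap (@floor_def _ _ m).
  by rewrite addrK.
by rewrite intrD; apply/andP; split; lra.
Qed.

(** The class of [x] modulo 1 lies in the arc of length a quarter turn centred at
    [ctr]. *)
Definition near_arc ctr x : Prop := exists m : int, `|x - ctr - m%:~R| < 1 / 8.

(** Inside an arc shorter than half a turn, displacements on the circle are those
    of lifts to the line. *)
Lemma wrap_arcD ctr x y z : near_arc ctr x -> near_arc ctr y -> near_arc ctr z ->
  wrap (y - x) + wrap (z - y) = wrap (z - x).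
Proof.
have wrapE u v m l : `|u - ctr - m%:~R| < 1 / 8 -> `|v - ctr - l%:~R| < 1 / 8 ->
    wrap (v - u) = (v - ctr - l%:~R) - (u - ctr - m%:~R).
  move=> um vl.
  rewrite -[X in _ = X](@wrap_small (l - m)).
    by congr wrap; rewrite intrB; ring.
  move: um vl; rewrite !ltr_norml => /andP[? ?] /andP[? ?].
  by apply/andP; split; lra.
move=> [a xa] [b yb] [c zc].
by rewrite (wrapE x y a b) // (wrapE y z b c) // (wrapE x z a c) //; ring.
Qed.

(** The displacements cancel around each cell of the grid, hence around its
    boundary: a discrete form of homotopy invariance. *)
Lemma grid_winding g (n : nat) :
  (forall r j, (r < n)%N -> (j < n)%N -> exists ctr,
    [/\ near_arc ctr (g r j), near_arc ctr (g r.+1 j), near_arc ctr (g r j.+1)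
      & near_arc ctr (g r.+1 j.+1)]) ->
  \sum_(j < n) wrap (g 0 j.+1 - g 0 j) + \sum_(r < n) wrap (g r.+1 n - g r n)
  = \sum_(r < n) wrap (g r.+1 0 - g r 0) + \sum_(j < n) wrap (g n j.+1 - g n j).
Proof.
move=> cell.
have strip r m : (r < n)%N -> (m <= n)%N ->
    \sum_(j < m) wrap (g r j.+1 - g r j) + wrap (g r.+1 m - g r m)
    = wrap (g r.+1 0 - g r 0) + \sum_(j < m) wrap (g r.+1 j.+1 - g r.+1 j).
  move=> rn; elim: m => [|m IHm] mn; first by rewrite !big_ord0 addr0 add0r.
  have [ctr [a b c d]] := cell r m rn mn.
  rewrite !big_ord_recr /= [X in _ = X]addrA -(IHm (ltnW mn)).
  rewrite -[X in X = _]addrA -[X in _ = X]addrA; congr (_ + _).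
  by rewrite (wrap_arcD a c d) (wrap_arcD a b d).
suff rows m : (m <= n)%N -> \sum_(j < n) wrap (g 0 j.+1 - g 0 j)
     + \sum_(r < m) wrap (g r.+1 n - g r n)
   = \sum_(r < m) wrap (g r.+1 0 - g r 0)
     + \sum_(j < n) wrap (g m j.+1 - g m j) by exact: rows.
elim: m => [|m IHm] mn; first by rewrite !big_ord0 addr0 add0r.
rewrite !big_ord_recr /= [X in X = _]addrA (IHm (ltnW mn)).
rewrite -[X in X = _]addrA -[X in _ = X]addrA; congr (_ + _).
exact: strip.
Qed.

End Winding.

(** * Circle-valued coordinates of the torus *)

Section CircleCoordinate.
Variables (R : realType) (k : nat).
Hypothesis k_gt0 : (0 < k)%N.

(** Inverse of [hex_point]: [lattice_coord true] is the first coordinate in the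
    basis of the triangular lattice, [lattice_coord false] the second one. *)
Definition lattice_coord (i : bool) (p : R * R) : R :=
  let v := p.2 / (Num.sqrt 3 / 2) in if i then p.1 - v / 2 else v.

Lemma lattice_coord_hex i u v :
  lattice_coord i (hex_point u v) = if i then u else v.
Proof.
have s_gt0 : 0 < Num.sqrt 3 :> R by rewrite sqrtr_gt0; lra.
rewrite /lattice_coord /hex_point /=; case: i; field; exact: lt0r_neq0.
Qed.

Lemma lattice_coordD i p q :
  lattice_coord i (p + q) = lattice_coord i p + lattice_coord i q.
Proof. by case: p q => [a b] [c d]; rewrite /lattice_coord /=; case: i; ring. Qed.

Lemma lattice_coord_continuous i : continuous (lattice_coord i).
Proof.
have cst_mul (f : R * R -> R) c : continuous f -> continuous (fun p => f p * c).
  by move=> cf p; apply: cvgM; [exact: cf | exact: cvg_cst].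
have c1 : continuous (fst : R * R -> R) by move=> p; exact: cvg_fst.
have c2 : continuous (snd : R * R -> R) by move=> p; exact: cvg_snd.
have c2' := cst_mul _ (Num.sqrt 3 / 2)^-1 c2.
rewrite /lattice_coord; case: i; last exact: c2'.
have c2'' := cst_mul _ 2^-1 c2'.
by move=> p; apply: cvgB; [exact: c1 | exact: c2''].
Qed.

(** Only the class modulo 1 depends on the point of the torus rather than on
    the chosen representative. *)
Definition circle_coord i (z : torus R k) : R := lattice_coord i (repr z) / k%:R.

Lemma circle_coord_pi i p :
  exists m : int, circle_coord i (torus_pi k p) = lattice_coord i p / k%:R + m%:~R.
Proof.
have /eqmodP /asboolP[a [b pab]] : (\pi_{eq_quot (torus_equiv R k)} (repr (torus_pi k p)) =
     \pi_{eq_quot (torus_equiv R k)} p)%qT by rewrite /torus_pi; exact: reprK.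
exists (if i then a else b); rewrite /circle_coord pab.
rewrite lattice_coordD lattice_coord_hex.
by case: i {pab}; field; rewrite pnatr_eq0 -lt0n.
Qed.

Lemma torus_pi_continuous : continuous (torus_pi k : R * R -> torus R k).
Proof. exact: pi_continuous. Qed.

Lemma near_arc_int (ctr x : R) (m : int) :
  near_arc ctr (x + m%:~R) <-> near_arc ctr x.
Proof.
split=> -[l xl].
  by exists (l - m); move: xl; congr (`|_| < _); rewrite intrB; ring.
by exists (l + m); move: xl; congr (`|_| < _); rewrite intrD; ring.
Qed.

Lemma open_arc i ctr : open [set z | near_arc ctr (circle_coord i z)]%classic.
Proof.
rewrite /open /= /quotient_open.
set A := (_ @^-1` _)%classic.
have -> : A = (\bigcup_(m in [set: int])
   (fun p => lattice_coord i p / k%:R - ctr - m%:~R) @^-1` (ball (0:R) (1 / 8)))%classic.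
  apply/seteqP; split=> p; rewrite /A /=.
    have [m] := circle_coord_pi i p; rewrite /torus_pi => -> /near_arc_int[l pl].
    by exists l => //=; rewrite -ball_normE /= sub0r normrN.
  have [m] := circle_coord_pi i p; rewrite /torus_pi => -> [l _] /=.
  rewrite -ball_normE /= sub0r normrN => pl; apply/near_arc_int.
  by exists l.
apply: bigcup_open => m _; apply: open_comp; last exact: ball_open.
move=> p _; apply: cvgB; last exact: cvg_cst.
apply: cvgB; last exact: cvg_cst.
apply: cvgM; last exact: cvg_cst.
exact: lattice_coord_continuous.
Qed.

(** Lebesgue number argument: by compactness of the unit square, a single mesh
    works for the cover of the square by the preimages of short arcs. *)
Lemma square_fine_arcs (S : set (torus R k)) (H : R * torus R k -> torus R k)
    (s : R -> torus R k) i :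
  {within `[0, 1] `*` S, continuous H}%classic ->
  continuous s -> (forall l, 0 <= l <= 1 -> S (s l)) ->
  exists N0, forall N, (N0 <= N)%N -> forall a b, 0 <= a <= 1 -> 0 <= b <= 1 ->
   exists ctr, forall a' b', 0 <= a' <= 1 -> 0 <= b' <= 1 ->
    `|a - a'| <= N.+1%:R^-1 -> `|b - b'| <= N.+1%:R^-1 ->
     near_arc ctr (circle_coord i (H (a', s b'))).
Proof.
move=> /subspace_continuousP contH conts Ss.
pose K := (`[0, 1] `*` `[0, 1] : set (R * R))%classic.
have : compact K by apply: compact_setX; exact: segment_compact.
move=> /compact_near_coveringP covK.
pose P N (p : R * R) := exists ctr, forall a' b', 0 <= a' <= 1 -> 0 <= b' <= 1 ->
    `|p.1 - a'| <= N.+1%:R^-1 -> `|p.2 - b'| <= N.+1%:R^-1 ->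
     near_arc ctr (circle_coord i (H (a', s b'))).
suff Kloc : forall p, K p -> (\forall p' \near p & N \near \oo, P N p')%classic.
  have [N0 _ KP] := covK nat (\oo)%classic P _ Kloc.
  by exists N0 => N NN0 a b ha hb; apply: (KP N NN0 (a, b)); split; rewrite /= in_itv.
move=> [a b] [/= ]; rewrite !in_itv /= => ha hb.
pose ctr := circle_coord i (H (a, s b)).
have nearA : \forall q \near nbhs ((a, s b) : R * torus R k),
    (`[0, 1] `*` S)%classic q -> near_arc ctr (circle_coord i (H q)).
  have arcH : nbhs (H (a, s b)) [set z | near_arc ctr (circle_coord i z)]%classic.
    apply: open_nbhs_nbhs; split; first exact: open_arc.
    by exists 0; rewrite /ctr subrr subr0 normr0; lra.
  have Dab : (`[0, 1] `*` S)%classic (a, s b).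
    by split; rewrite /= ?in_itv //; exact: Ss.
  exact: (contH (a, s b) Dab _ arcH).
have nearB : \forall q \near nbhs ((a, b) : R * R),
    (`[0, 1] `*` S)%classic (q.1, s q.2) -> near_arc ctr (circle_coord i (H (q.1, s q.2))).
  have cvgH : ((fun q : R * R => (q.1, s q.2)) @ nbhs (a, b) --> (a, s b))%classic.
    apply: (@cvg_pair _ _ _ (nbhs (a, b)) (nbhs a) (nbhs (s b)) _ _ _ fst (s \o snd)).
      exact: cvg_fst.
    by apply: (cvg_comp snd s); [exact: cvg_snd | exact: conts].
  exact: (cvgH _ nearA).
have [e /= e_gt0 ballP] := (iffLR (nbhs_ballP _ _)) nearB.
have e2_gt0 : 0 < e / 2 by lra.
exists (ball ((a, b) : R * R) (e / 2), [set N | N.+1%:R^-1 < e / 2])%classic.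
  split => /=; first exact: nbhsx_ballx.
  exact: (near_infty_natSinv_lt (PosNum e2_gt0)).
move=> [[a1 b1] N] [/= [/= + +] Ne]; rewrite -!ball_normE /= => aa1 bb1.
have triangle (x y z : R) :
    `|x - y| < e / 2 -> `|y - z| <= N.+1%:R^-1 -> `|x - z| < e.
  move=> xy yz; rewrite -(subrKA y); apply: le_lt_trans (ler_normD _ _) _.
  by rewrite [X in _ < X](splitr e) ltrD //; exact: le_lt_trans Ne.
exists ctr => /= a' b' ha' hb' aa' bb'.
apply: (ballP (a', b')); last by split; rewrite /= ?in_itv //; exact: Ss.
split; rewrite /= -ball_normE /=.
  exact: triangle aa1 aa'.
exact: triangle bb1 bb'.
Qed.

End CircleCoordinate.

(** * Contractible drawings do not wind *)

Section Unwinding.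
Variables (R : realType) (k : nat).
Hypothesis k_gt0 : (0 < k)%N.
Implicit Types (C : {set edge k}) (e : edge k).

Definition edge_curve e (l : R) : torus R k :=
  let: (s, t, d) := e in
  torus_pi k (hex_point ((val s)%:R + 1 / 3 + l * (edge_vector R d).1)
                        ((val t)%:R + 1 / 3 + l * (edge_vector R d).2)).

Definition edge_shift (i : bool) e : R :=
  if i then (edge_vector R e.2).1 else (edge_vector R e.2).2.

Lemma edge_shift_le1 i e : `|edge_shift i e| <= 1.
Proof.
by rewrite /edge_shift /edge_vector ler_norml; case: e => [p [[|[|[|m]]] h]];
  case: i => /=; apply/andP; split; lra.
Qed.

Lemma edge_curve_continuous e : continuous (edge_curve e).
Proof.
have affine (a b : R) : continuous (fun l : R => a + l * b).
  move=> l; apply: (cvgD (cvg_cst _)).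
  exact: (cvgM cvg_id (cvg_cst _)).
case: e => [[s t] d].
pose phi (l : R) := hex_point ((val s)%:R + 1 / 3 + l * (edge_vector R d).1)
                              ((val t)%:R + 1 / 3 + l * (edge_vector R d).2).
have phi_cont : continuous phi.
  move=> l; apply: (@cvg_pair _ _ _ (nbhs l) (nbhs _) (nbhs _)).
    apply: cvgD; first exact: affine.
    exact: (cvgM (affine _ _ _) (cvg_cst _)).
  exact: (cvgM (affine _ _ _) (cvg_cst _)).
move=> l; exact: (cvg_comp phi (torus_pi k) (phi_cont l) (@torus_pi_continuous R k _)).
Qed.

Lemma circle_coord_edge_curve i e l : exists m : int,
  circle_coord i (edge_curve e l) =
  circle_coord i (edge_curve e 0) + l * (edge_shift i e / k%:R) + m%:~R.
Proof.
case: e => [[s t] d]; rewrite /edge_curve /edge_shift /=.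
have [m ->] := circle_coord_pi k_gt0 i (hex_point
  ((val s)%:R + 1 / 3 + l * (edge_vector R d).1)
  ((val t)%:R + 1 / 3 + l * (edge_vector R d).2)).
have [m' ->] := circle_coord_pi k_gt0 i (hex_point
  ((val s)%:R + 1 / 3 + 0 * (edge_vector R d).1)
  ((val t)%:R + 1 / 3 + 0 * (edge_vector R d).2)).
exists (m - m'); rewrite !lattice_coord_hex intrB.
by case: i; ring.
Qed.

(** The value of [tau] at a point is the total displacement of this point along the
    homotopy. At time 1 everything is at one point, so by [grid_winding] the
    displacement along an edge at time 0 is the difference of the values of [tau]
    at the two endpoints. *)
Lemma contractible_unwinds i C : contractible_in R (drawing (R := R) C) ->
  exists tau : torus R k -> R, forall e, e \in C ->
    edge_shift i e / k%:R = tau (edge_curve e 0) - tau (edge_curve e 1).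
Proof.
move=> [H [contH H0 [c Hc]]].
have onC e (l : R) : e \in C -> 0 <= l <= 1 -> drawing C (edge_curve e l).
  by move=> eC l01; exists e => //; move: e eC => [[s t] d] _; exists l.
have /choice[f fP] : forall e, exists N0, e \in C -> forall N, (N0 <= N)%N ->
   forall a b, 0 <= a <= 1 -> 0 <= b <= 1 ->
   exists ctr, forall a' b', 0 <= a' <= 1 -> 0 <= b' <= 1 ->
    `|a - a'| <= N.+1%:R^-1 -> `|b - b'| <= N.+1%:R^-1 ->
     near_arc ctr (circle_coord i (H (a', edge_curve e b'))).
  move=> e; case: (boolP (e \in C)) => eC; last by exists 0%N.
  have [N0 N0P] := square_fine_arcs k_gt0 i contH (@edge_curve_continuous e)
    (fun l => @onC e l eC).
  by exists N0.
(* The mesh has to suit all the edges at once; moreover, at least three steps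
   make each step along an edge shorter than half a turn. *)
pose n := (\max_e f e + 2)%N.+1.
have n_gt0 : 0 < n%:R :> R by rewrite ltr0n.
have n_neq0 : n%:R != 0 :> R by rewrite pnatr_eq0.
have grid01 j : (j <= n)%N -> 0 <= (j%:R / n%:R : R) <= 1.
  by move=> jn; rewrite divr_ge0 //= ler_pdivrMr // mul1r ler_nat.
have step j : j.+1%:R / n%:R = j%:R / n%:R + n%:R^-1 :> R.
  by rewrite -natr1 mulrDl mul1r.
have near_self (x : R) : `|x - x| <= n%:R^-1 by rewrite subrr normr0 invr_ge0 ltW.
have near_step (x : R) : `|x - (x + n%:R^-1)| <= n%:R^-1.
  by rewrite opprD addrA subrr sub0r normrN ger0_norm ?invr_ge0 // ltW.
exists (fun z => \sum_(r < n) wrap (circle_coord i (H (r.+1%:R / n%:R, z))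
   - circle_coord i (H (r%:R / n%:R, z)))) => e eC.
pose g (r j : nat) := circle_coord i (H (r%:R / n%:R, edge_curve e (j%:R / n%:R))).
have := @grid_winding R g n; rewrite /g.
rewrite divff // !mul0r => winding.
have bottom j : (j < n)%N -> wrap (circle_coord i (H (0, edge_curve e (j.+1%:R / n%:R)))
   - circle_coord i (H (0, edge_curve e (j%:R / n%:R)))) = edge_shift i e / k%:R / n%:R.
  move=> jn; rewrite !H0; try by apply: onC => //; apply: grid01; rewrite // ltnW.
  have [m ->] := circle_coord_edge_curve i e (j.+1%:R / n%:R).
  have [m' ->] := circle_coord_edge_curve i e (j%:R / n%:R).
  rewrite -[X in _ = X](@wrap_small _ (m - m')).
    by congr wrap; rewrite intrB step; ring.
  rewrite !normrM !normfV !normr_nat ltr_pdivrMr //.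
  have le1 : `|edge_shift i e| / k%:R <= 1.
    by rewrite ler_pdivrMr ?ltr0n // mul1r (le_trans (edge_shift_le1 i e)) // ler1n.
  apply: le_lt_trans le1 _.
  have : (3%:R <= n%:R :> R) by rewrite ler_nat /n addn2.
  by lra.
have top j : (j < n)%N -> wrap (circle_coord i (H (1, edge_curve e (j.+1%:R / n%:R)))
   - circle_coord i (H (1, edge_curve e (j%:R / n%:R)))) = 0.
  move=> jn; rewrite !Hc; try by apply: onC => //; apply: grid01; rewrite // ltnW.
  by rewrite subrr -[X in wrap X](addr0 0) (@wrap_small _ 0) // normr0; lra.
rewrite (eq_bigr (fun=> edge_shift i e / k%:R / n%:R)) in winding; last first.
  by move=> j _; exact: bottom.
rewrite [X in _ = _ + X]big1 in winding; last by move=> j _; exact: top.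
have sumE (x : R) : \sum_(j < n) (x / n%:R) = x.
  by rewrite sumr_const card_ord -[X in X = _]mulr_natr divfK.
rewrite sumE addr0 in winding.
rewrite -winding ?addrK // => r j rn jn.
have fn : (f e <= n.-1)%N by rewrite /n /= (leq_trans (leq_bigmax e)) // leq_addr.
have [ctr ctrP] := fP e eC _ fn _ _ (grid01 _ (ltnW rn)) (grid01 _ (ltnW jn)).
exists ctr; split; apply: ctrP; rewrite ?grid01 // 1?ltnW //.
all: by rewrite ?step ?near_self ?near_step.
Qed.

End Unwinding.

Section SeamTopology.
Variables (R : realType) (k : nat).
Hypothesis k_gt0 : (0 < k)%N.
Implicit Types (C : {set edge k}) (e : edge k).

Lemma natr_ord_pred (s : 'I_k) :
  (val (ord_pred s))%:R = (val s)%:R - 1 + k%:R * (val s == 0)%N%:R :> R.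
Proof.
rewrite /ord_pred /=; case: s => -[|s] /= sk.
  rewrite add0n modn_small ?prednK // mulr1 add0r.
  by rewrite -[in X in _ = X](prednK k_gt0) -natr1; ring.
by rewrite ?addSn /= modnDr modn_small ?(ltnW sk) // mulr0 addr0 -natr1 addrK.
Qed.

Definition vertex_coord (i : bool) (v : vertex k) : R :=
  let: (s, t, b) := v in
  (if i then val s else val t)%:R + (if b then 2 / 3 else 1 / 3).

Definition vertex_point (v : vertex k) : torus R k :=
  torus_pi k (hex_point (vertex_coord true v) (vertex_coord false v)).

(** The seams account exactly for the difference between the displacement along
    an edge and the difference of the coordinates, taken between [0] and [k], of
    its endpoints. *)
Lemma vertex_coord_edge i e :
  vertex_coord i (edge_tgt e) - vertex_coord i (edge_src e)
  = edge_shift R i e + k%:R * (seam i e)%:R.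
Proof.
case: e => [[s t] [[|[|[|d]]] hd]]; rewrite // /edge_shift /edge_vector /=;
case: i => //=; rewrite ?natr_ord_pred ?andbF ?andbT ?mulr0; lra.
Qed.

Lemma torus_pi_lattice p (a b : int) :
  torus_pi k (p + hex_point (k%:R * a%:~R) (k%:R * b%:~R)) = torus_pi k p :> torus R k.
Proof. by apply/eqmodP/asboolP; exists a, b. Qed.

Lemma edge_curve0 e : edge_curve e (0 : R) = vertex_point (edge_src e).
Proof. by case: e => [[s t] d]; rewrite /edge_curve /vertex_point /= !mul0r !addr0. Qed.

Lemma edge_curve1 e : edge_curve e (1 : R) = vertex_point (edge_tgt e).
Proof.
rewrite /vertex_point.
have := vertex_coord_edge true e; have := vertex_coord_edge false e.
move=> /(canRL (subrK _)) -> /(canRL (subrK _)) ->.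
rewrite -(torus_pi_lattice _ (- (seam true e)%:Z) (- (seam false e)%:Z)).
case: e => [[s t] d]; rewrite /edge_curve /edge_shift /=.
congr torus_pi; rewrite /hex_point !rmorphN /= -!pmulrn.
by congr pair => /=; ring.
Qed.

Lemma odd_absz_addb (m : int) (b : bool) :
  odd (absz (m + (nat_of_bool b)%:Z)) = odd (absz m) (+) b.
Proof. case: b; lia. Qed.

(** The crossing indicator is the difference of a real function [Psi] along the
    edges. Being integer, the difference changes the parity of the integral part
    of [Psi] accordingly, so the seam restricted to [C] is a coboundary
    modulo 2. *)
Lemma contractible_seam0 i C : loop_config C ->
  contractible_in R (drawing (R := R) C) -> \sum_(e in C) seam i e = 0.
Proof.
move=> evenC /(contractible_unwinds k_gt0 i)[tau tauP].
pose Psi v := vertex_coord i v / k%:R + tau (vertex_point v).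
have PsiE e : e \in C -> Psi (edge_tgt e) = Psi (edge_src e) + (seam i e)%:R.
  move=> eC; have := tauP e eC; rewrite edge_curve0 edge_curve1 /Psi.
  have -> : vertex_coord i (edge_tgt e) =
     vertex_coord i (edge_src e) + edge_shift R i e + k%:R * (seam i e)%:R.
    by rewrite -addrA -vertex_coord_edge addrC subrK.
  rewrite !mulrDl [k%:R * _]mulrC mulfK ?pnatr_eq0 -?lt0n // => ->; ring.
pose f v := odd (absz (Num.floor (Psi v))).
rewrite (eq_bigr (coboundary f)); first exact: even_sum_coboundary.
move=> e eC; rewrite /coboundary /f (PsiE e eC).
have -> : (seam i e)%:R = ((seam i e)%:Z)%:~R :> R by [].
move: (Psi _) => x; rewrite floorDrz ?intr_int // intrKfloor odd_absz_addb.
by rewrite [X in _ = X]addbA addbb.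
Qed.

End SeamTopology.

(** * Weighted colourings *)

(** Binomial expansion, with the elements of [S] forced into [D]. *)
Lemma sum_sets_between (R : comNzRingType) (T : finType) (S L : {set T}) (a b : R) :
  S \subset L ->
  \sum_(D : {set T} | (S \subset D) && (D \subset L)) a ^+ #|D| * b ^+ #|L :\: D|
  = a ^+ #|S| * (a + b) ^+ #|L :\: S|.
Proof.
move=> SL.
(* The choice of [D] amounts to choosing [F i] for [i] in [D] and [G i] otherwise;
   the zeros exclude the sets that are not between [S] and [L]. *)
pose F i := if i \in L then a else 0.
pose G i := if i \in L then (if i \in S then 0 else b) else 1.
have -> : a ^+ #|S| * (a + b) ^+ #|L :\: S| = \prod_i (F i + G i).
  rewrite -!prodr_const [X in X * _]big_mkcond [X in _ * X]big_mkcond -big_split /=.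
  apply: eq_bigr => i _; rewrite inE /F /G.
  case: (boolP (i \in S)) => iS /=; first by rewrite (fintype.subsetP SL i iS) mulr1 addr0.
  by case: (i \in L); rewrite ?mul1r ?add0r.
rewrite bigA_distr big_mkcond /=; apply: eq_bigr => D _.
have [/andP[SD DL]|] := ifPn.
  rewrite -!prodr_const [X in X * _]big_mkcond [X in _ * X]big_mkcond -big_split /=.
  apply: eq_bigr => i _; rewrite inE /F /G.
  case: (boolP (i \in D)) => iD /=; first by rewrite (fintype.subsetP DL i iD) mulr1.
  have /negbTE -> : i \notin S by apply: contra iD => /(fintype.subsetP SD).
  by case: (i \in L); rewrite ?mul1r.
rewrite negb_and => /orP[] /subsetPn[i].
  move=> iS /negbTE iD.
  by rewrite (bigD1 i) //= iD /G iS (fintype.subsetP SL i iS) mul0r.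
by move=> iD /negbTE iL; rewrite (bigD1 i) //= iD /F iL mul0r.
Qed.

(** For [q = 1] this is the pairing of a set with its complement. In general,
    write [q ^+ #|S|] as a sum over the sets [D] between [S] and [L] of weights
    that depend on [D] only, and use complements inside each [D]. *)
Lemma colouring_half (R : realDomainType) (T : finType) (L : {set T})
    (good : pred {set T}) (q : R) :
  0 <= q <= 1 ->
  (forall S S' : {set T}, S \subset L -> S' \subset L ->
     [disjoint S & S'] -> good S || good S') ->
  (1 + q) ^+ #|L| <= (\sum_(S : {set T} | (S \subset L) && good S) q ^+ #|S|) *+ 2.
Proof.
move=> /andP[q_ge0 q_le1] dual.
have expand (P : pred {set T}) :
   \sum_(S : {set T} | (S \subset L) && P S) q ^+ #|S| =
   \sum_(D : {set T} | D \subset L) q ^+ #|D| * (1 - q) ^+ #|L :\: D|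
       *+ #|[set S : {set T} | (S \subset D) && P S]|.
  transitivity (\sum_(S : {set T} | (S \subset L) && P S)
     \sum_(D : {set T} | (S \subset D) && (D \subset L))
        q ^+ #|D| * (1 - q) ^+ #|L :\: D|).
    apply: eq_bigr => S /andP[SL _]; rewrite sum_sets_between //.
    by rewrite subrKC expr1n mulr1.
  rewrite (exchange_big_dep (fun D : {set T} => D \subset L)) /=; last first.
    by move=> S D _ /andP[].
  apply: eq_bigr => D DL; rewrite sumr_const; congr (_ *+ _).
  rewrite cardsE; apply: eq_card => S; rewrite !unfold_in /= DL andbT andbC andbA.
  case: (boolP (S \subset D)) => //= SD.
  by rewrite (fintype.subset_trans SD DL).
have -> : (1 + q) ^+ #|L| = \sum_(S : {set T} | (S \subset L) && xpredT S) q ^+ #|S|.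
  have := sum_sets_between q 1 (finset.sub0set L).
  rewrite cards0 expr0 mul1r finset.setD0 addrC => <-.
  by apply: eq_big => S; rewrite ?finset.sub0set ?andbT // expr1n mulr1.
rewrite !expand -sumrMnl ler_sum // => D DL.
rewrite -mulrnA ler_wpMn2l //.
  by rewrite mulr_ge0 ?exprn_ge0 // subr_ge0.
set good_in := [set S : {set T} | _ & good S].
have -> : (#|good_in| * 2 = #|good_in| + #|(fun S => D :\: S) @: good_in|)%N.
  rewrite card_in_imset ?muln2 ?addnn // => S S'; rewrite !inE.
  move=> /andP[SD _] /andP[S'D _] /(congr1 (fun X => D :\: X)).
  rewrite !finset.setDDr !finset.setDv !finset.set0U.
  by rewrite (finset.setIidPr SD) (finset.setIidPr S'D).
apply: leq_trans (leq_card_setU _ _); apply: subset_leq_card.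
apply/fintype.subsetP => S; rewrite !inE andbT => SD; rewrite SD /=.
have := dual S (D :\: S) (fintype.subset_trans SD DL)
  (fintype.subset_trans (finset.subsetDl _ _) DL).
case: (boolP (good S)) => //= _ goodDS; apply/imsetP; exists (D :\: S).
  by rewrite inE finset.subsetDl goodDS // -finset.setI_eq0 finset.setIDA
     finset.setDIl finset.setDv finset.set0I.
by rewrite finset.setDDr finset.setDv finset.set0U (finset.setIidPr SD).
Qed.

(** * Resampling along a detour *)

Lemma eq_connect_from (T : finType) (r r' : rel T) x :
  (forall u v, connect r x u -> r u v = r' u v) -> connect r x =1 connect r' x.
Proof.
move=> rr'; have pathE p u : connect r x u -> path r u p = path r' u p.
  elim: p u => //= v p IHp u xu; rewrite -(rr' u v xu).
  case: (boolP (r u v)) => //= uv; apply: IHp.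
  exact: connect_trans xu (connect1 uv).
move=> y; apply/connectP/connectP => -[p pathp ->]; exists p => //.
  by rewrite -pathE.
by rewrite pathE.
Qed.

Section Resampling.
Variable k : nat.
Implicit Types (w C B : {set edge k}) (e : edge k) (u v : vertex k).
Implicit Types (A : {set vertex k}) (S : {set {set vertex k}}).

(** The class in the homology modulo 2 of the torus is not zero: the two seams
    are dual to a basis. *)
Definition nontrivial w : bool :=
  (\sum_(e in w) seam true e : bool) || (\sum_(e in w) seam false e).

Definition coloured w S : {set edge k} :=
  [set e in w | [exists A in S, (edge_src e \in A) && (edge_tgt e \in A)]].

Definition detour B C : bool := [&& loop_config C, C \subset ~: B & nontrivial C].

(** The coloured loops leave room for a nontrivial even subgraph. *)
Definition avoidable w S : bool := [exists C, detour (coloured w S) C].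

Definition xor_set w C : {set edge k} := [set e | (e \in w) (+) (e \in C)].

Lemma component_eq w A A' v : A \in components w -> A' \in components w ->
  v \in A -> v \in A' -> A = A'.
Proof.
move=> Ac Ac' vA vA'; apply/setP => y.
by rewrite (component_connect _ Ac vA) (component_connect _ Ac' vA').
Qed.

(** If both sets leave no room, the seams can be moved onto the edges of [S] and
    of [S'] respectively; loops of the two sets have no common vertex, so
    [intersection_separated] contradicts [intersection_seam]. *)
Lemma avoidable_dual w S S' : (0 < k)%N ->
  S \subset components w -> S' \subset components w -> [disjoint S & S'] ->
  avoidable w S || avoidable w S'.
Proof.
move=> k_gt0 Sw S'w disj; apply/negPn; rewrite negb_or; apply/negP.
move=> /andP[/existsPn noS /existsPn noS'].
have flat i B (noB : forall C, ~~ detour B C) :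
    exists f, forall e, e \notin B -> seam i e = coboundary f e.
  have [C CB evenC|f fP] := @even_orthogonal_coboundary k (~: B) (seam i).
    have := noB C; rewrite /detour evenC CB /= negb_or => /andP[/negbTE t0 /negbTE f0].
    by case: i.
  by exists f => e eB; apply: fP; rewrite inE.
have [f fP] := flat true _ noS; have [g gP] := flat false _ noS'.
pose c e := seam true e + coboundary f e.
pose c' e := seam false e + coboundary g e.
have supp B i h e : (forall e, e \notin B -> seam i e = coboundary h e) ->
    (seam i e + coboundary h e)%R -> e \in B.
  move=> hP he; apply/negPn/negP => /hP E.
  by move: he; rewrite E; case: (coboundary h e).
have cocycleD h h' : cocycle (k := k) h -> cocycle h' -> cocycle (fun e => h e + h' e).
  move=> hc hc' s t; have E := congr2 +%R (hc s t) (hc' s t).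
  by rewrite addr0 in E; rewrite -[X in _ = X]E; ring.
have one : intersection c c' = 1.
  rewrite intersection_addl; last first.
    by apply: cocycleD; [exact: seam_cocycle|exact: coboundary_cocycle].
  by rewrite intersection_addr ?intersection_seam //; exact: seam_cocycle.
suff zero : intersection c c' = 0 by rewrite zero in one.
apply: intersection_separated.
- by apply: cocycleD; [exact: seam_cocycle|exact: coboundary_cocycle].
- by apply: cocycleD; [exact: seam_cocycle|exact: coboundary_cocycle].
move=> e e' v /(supp _ _ _ _ fP) + /(supp _ _ _ _ gP).
rewrite !inE => /andP[_ /existsP[A /and3P[AS srcA tgtA]]].
move=> /andP[_ /existsP[A' /and3P[AS' srcA' tgtA']]] ev ev'.
have vA : v \in A by have /orP[/eqP->|/eqP->] := ev.
have vA' : v \in A' by have /orP[/eqP->|/eqP->] := ev'.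
have AA' := component_eq (fintype.subsetP Sw A AS) (fintype.subsetP S'w A' AS') vA vA'.
by have := disjointFr disj AS; rewrite AA' AS'.
Qed.

Lemma sum_xor_set w C (h : edge k -> bool) :
  \sum_(e in xor_set w C) h e = \sum_(e in w) h e + \sum_(e in C) h e.
Proof.
rewrite big_mkcond [X in _ = X + _]big_mkcond [X in _ = _ + X]big_mkcond -big_split /=.
apply: eq_bigr => e _; rewrite inE.
by case: (e \in w); case: (e \in C) => //=; case: (h e).
Qed.

Lemma odd_degree w v : odd (degree w v) = \sum_(e in w) (incident e v : bool).
Proof.
rewrite -natr_bool /degree -sum1_card natr_sum [LHS]big_mkcond [RHS]big_mkcond /=.
by apply: eq_bigr => e _; rewrite inE; case: (e \in w); case: (incident e v).
Qed.

Lemma xor_set_even w C : loop_config w -> loop_config C -> loop_config (xor_set w C).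
Proof.
move=> /forallP evenw /forallP evenC; apply/forallP => v.
rewrite odd_degree sum_xor_set -!odd_degree.
by rewrite (negbTE (evenw v)) (negbTE (evenC v)).
Qed.

Lemma xor_setK w C : xor_set (xor_set w C) C = w.
Proof. by apply/setP => e; rewrite !inE addbK. Qed.

Lemma nontrivial_xor_set w C :
  ~~ nontrivial w -> nontrivial C -> nontrivial (xor_set w C).
Proof.
rewrite /nontrivial negb_or => /andP[/negbTE t0 /negbTE f0].
by rewrite !sum_xor_set t0 f0 !add0r.
Qed.

Lemma loop_is_component w A : A \in loops w -> A \in components w.
Proof. by rewrite inE => /andP[]. Qed.

(** At a vertex of a coloured loop at least two edges are coloured; an even
    subgraph through this vertex would need two further ones. *)
Lemma detour_avoids_loop w S C A e v :
  loop_config w -> S \subset loops w -> loop_config C ->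
  C \subset ~: coloured w S ->
  A \in S -> v \in A -> incident e v -> e \notin C.
Proof.
move=> evenw Sw evenC CS AS vA ev; apply/negP => eC.
have AL := fintype.subsetP Sw A AS; have Ac := loop_is_component AL.
have [e0 e0w ev0] : exists2 e0, e0 \in w & incident e0 v.
  move: AL; rewrite inE => /andP[_ /asboolP[m [x [c [_ _ AE cE cj]]]]].
  move: (vA); rewrite {1}AE => /imsetP[i _ vE]; exists (c i).
    have : c i \in edges_in w A by rewrite cE imset_f.
    by rewrite inE => /andP[].
  by rewrite vE; exact: joins_incident (cj i).
have two D e1 : loop_config D -> e1 \in D -> incident e1 v -> (1 < degree D v)%N.
  move=> /forallP/(_ v) + e1D e1v.
  have : (0 < degree D v)%N by apply/card_gt0P; exists e1; rewrite inE e1D.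
  by case: (degree D v) => [|[|d]].
have := incident_le3 v; rewrite leqNgt => /negP; apply.
apply: (@leq_trans (degree w v + degree C v)%N).
  exact: (leq_add (two w e0 evenw e0w ev0) (two C e evenC eC ev)).
have -> : (degree w v + degree C v =
  #|[set e in w | incident e v] :|: [set e in C | incident e v]|)%N.
  rewrite finset.cardsU [X in (_ - X)%N](_ : _ = 0%N) ?subn0 //.
  apply/eqP; rewrite cards_eq0; apply/eqP/setP => e1; rewrite !inE.
  apply/negP => /andP[/andP[e1w e1v] /andP[e1C _]].
  have := fintype.subsetP CS e1 e1C; rewrite !inE e1w /= => /existsP; apply.
  exists A; rewrite AS /=; have := e1w.
  by rewrite -(edges_in_component Ac vA e1v) inE => /andP[].
by apply: subset_leq_card; apply/fintype.subsetP => e1; rewrite !inE => /orP[] /andP[].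
Qed.

(** The edges at the vertices of a coloured loop are the same before and after,
    so the coloured loops remain components. That the set of coloured edges is
    unchanged makes the resampling map an involution. *)
Lemma xor_set_keeps_loops w S C :
  loop_config w -> S \subset loops w -> loop_config C -> C \subset ~: coloured w S ->
  S \subset loops (xor_set w C) /\ coloured (xor_set w C) S = coloured w S.
Proof.
move=> evenw Sw evenC CS.
have memE A e v : A \in S -> v \in A -> incident e v -> (e \in xor_set w C) = (e \in w).
  move=> AS vA ev; rewrite inE.
  by rewrite (negbTE (detour_avoids_loop evenw Sw evenC CS AS vA ev)) addbF.
have src e : incident e (edge_src e) by rewrite /incident eqxx.
split; last first.
  apply/setP => e; rewrite !inE; apply/andb_id2r => /existsP[A /and3P[AS srcA _]].
  by have := memE A e _ AS srcA (src e); rewrite inE.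
apply/fintype.subsetP => A AS; have AL := fintype.subsetP Sw A AS.
have Ac := loop_is_component AL; move: AL; rewrite !inE => /andP[_ /asboolP cycA].
have -> : edges_in (xor_set w C) A = edges_in w A.
  apply/setP => e; rewrite !inE; apply/andb_id2r => /andP[srcA _].
  by have := memE A e _ AS srcA (src e); rewrite inE.
rewrite (asboolT cycA) andbT; apply/componentsP.
have /componentsP[x AE] := Ac; exists x; rewrite {1}AE.
apply/setP => y; rewrite !inE; apply: eq_connect_from => u v xu.
have uA : u \in A by rewrite AE inE.
apply: eq_existsb => e; case: (boolP (joins e u v)) => euv; rewrite ?andbF // !andbT.
by rewrite (memE A e u AS uA (joins_incident euv)).
Qed.

End Resampling.

(** * The lower bound *)

Section Conclusion.
Variables (R : realType) (k : nat).
Hypothesis k_gt0 : (0 < k)%N.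
Implicit Types (w C : {set edge k}) (A : {set vertex k}) (S : {set {set vertex k}}).

Lemma edges_in_even w A :
  loop_config w -> A \in components w -> loop_config (edges_in w A).
Proof.
move=> /forallP evenw Ac; apply/forallP => v; case: (boolP (v \in A)) => vA.
  suff -> : degree (edges_in w A) v = degree w v by exact: evenw.
  apply: eq_card => e; rewrite [LHS]inE [RHS]inE; apply/andb_id2r => ev.
  exact: edges_in_component Ac vA ev.
suff -> : degree (edges_in w A) v = 0%N by [].
apply/eqP; rewrite cards_eq0; apply/eqP/setP => e; rewrite !inE.
apply/negP => /andP[/and3P[_ srcA tgtA] /orP[/eqP vE|/eqP vE]].
  by move: vA; rewrite vE srcA.
by move: vA; rewrite vE tgtA.
Qed.

Lemma sum_components w (h : edge k -> bool) :
  \sum_(e in w) h e = \sum_(A in components w) \sum_(e in edges_in w A) h e.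
Proof.
pose comp v := [set y | connect (adjacent w) v y].
have compP v : comp v \in components w by apply/componentsP; exists v.
rewrite (partition_big (fun e => comp (edge_src e)) (mem (components w))) //=.
apply: eq_bigr => A Ac; apply: eq_bigl => e.
case: (boolP (edge_src e \in A)) => srcA; last first.
  rewrite [RHS]inE (negbTE srcA) /= andbF.
  by apply/negP => /andP[_ /eqP AE]; rewrite -AE inE connect0 in srcA.
rewrite (edges_in_component Ac srcA) /incident ?eqxx //.
suff -> : comp (edge_src e) == A by rewrite andbT.
apply/eqP/(component_eq (compP _) Ac _ srcA); by rewrite inE connect0.
Qed.

(** The class is additive over the components, so one of them is nontrivial; it
    contains an edge and is therefore a loop. *)
Lemma nontrivial_noncontractible w :
  loop_config w -> nontrivial w -> has_noncontractible_loop R w.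
Proof.
move=> evenw nt.
have [i sum_neq0] : exists i, \sum_(e in w) seam i e != 0.
  by have /orP[t|t] := nt; [exists true|exists false]; rewrite t.
have [A Ac sumA] : exists2 A, A \in components w & \sum_(e in edges_in w A) seam i e != 0.
  apply/exists_inP; apply: contraNT sum_neq0 => /exists_inPn noA.
  by rewrite sum_components big1 // => A Ac; apply/eqP/negPn/noA.
have [e0 e0A] : exists e0, e0 \in edges_in w A.
  by apply/set0Pn; apply: contraNneq sumA => ->; rewrite big_set0.
exists A; first by rewrite inE Ac; apply/asboolP/(component_simple_cycle evenw Ac e0A).
move=> contr; move: sumA.
by rewrite (contractible_seam0 k_gt0 i (edges_in_even evenw Ac) contr) eqxx.
Qed.

(** Chosen from the coloured edges alone, so that the same detour is picked after
    resampling. *)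
Definition pick_detour (B : {set edge k}) : {set edge k} :=
  odflt finset.set0 [pick C | detour B C].

Lemma pick_detourP w S : avoidable w S ->
  detour (coloured w S) (pick_detour (coloured w S)).
Proof.
rewrite /pick_detour /avoidable => /existsP[C dC].
by case: pickP => [//|/(_ C)]; rewrite dC.
Qed.

(** The map that adds the chosen detour to the configuration preserves the
    colours and the weight, and is inverted by itself. *)
Lemma resampling_le (q : R) : 0 <= q ->
  \sum_(p : {set edge k} * {set {set vertex k}} |
     [&& loop_config p.1, p.2 \subset loops p.1, avoidable p.1 p.2
       & ~~ nontrivial p.1]) q ^+ #|p.2|
  <= \sum_(p : {set edge k} * {set {set vertex k}} |
     [&& loop_config p.1, p.2 \subset loops p.1 & nontrivial p.1]) q ^+ #|p.2|.
Proof.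
move=> q_ge0.
pose phi (p : {set edge k} * {set {set vertex k}}) :=
  (xor_set p.1 (pick_detour (coloured p.1 p.2)), p.2).
have phiP w S : loop_config w -> S \subset loops w -> avoidable w S ->
   ~~ nontrivial w ->
   [/\ phi (phi (w, S)) = (w, S), loop_config (phi (w, S)).1,
     S \subset loops (phi (w, S)).1 & nontrivial (phi (w, S)).1].
  move=> evenw Sw /pick_detourP/and3P[evenC CS ntC] trivw; rewrite /phi /=.
  have [Sw' ->] := xor_set_keeps_loops evenw Sw evenC CS.
  by rewrite xor_setK xor_set_even // nontrivial_xor_set.
(* As [phi] is an involution on the left-hand index set, the left-hand sum is
   also the sum over the image, and the image lies in the right-hand index set. *)
rewrite (reindex_onto phi phi) /=; last first.
  by move=> [w S] /and4P[evenw Sw avS tw]; have [] := phiP w S evenw Sw avS tw.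
rewrite [X in X <= _]big_mkcond [X in _ <= X]big_mkcond; apply: ler_sum => -[w S] _ /=.
case: ifP => [|_]; last by case: ifP => // _; exact: exprn_ge0.
move=> /andP[/and4P[evenw Sw avS tw] /eqP phiK].
have [_] := phiP _ S evenw Sw avS tw.
rewrite [phi (_, S)]phiK /= => -> -> ->.
by [].
Qed.

(** One factor 2 is lost in [colouring_half], the other one because the favourable
    pairs are split according to the class of the configuration and both parts
    are bounded by the same sum. *)
Lemma nontrivial_quarter (n : R) : 1 <= n <= 2 ->
  \sum_(w : {set edge k} | loop_config w) n ^+ #|loops w|
  <= (\sum_(w : {set edge k} | loop_config w && nontrivial w) n ^+ #|loops w|) *+ 4.
Proof.
move=> /andP[n_ge1 n_le2]; pose q := n - 1.
have q01 : 0 <= q <= 1 by apply/andP; split; rewrite /q; lra.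
have nE : n = 1 + q by rewrite /q addrC subrK.
have expand (P : pred {set edge k}) (Q : {set edge k} -> pred {set {set vertex k}}) :
   \sum_(w | P w) \sum_(S : {set {set vertex k}} | (S \subset loops w) && Q w S) q ^+ #|S|
   = \sum_(p : {set edge k} * {set {set vertex k}} |
        P p.1 && ((p.2 \subset loops p.1) && Q p.1 p.2)) q ^+ #|p.2|.
  by rewrite pair_big_dep.
have colour w : n ^+ #|loops w| =
    \sum_(S : {set {set vertex k}} | S \subset loops w) q ^+ #|S|.
  have := sum_sets_between q 1 (finset.sub0set (loops w)).
  rewrite cards0 expr0 mul1r finset.setD0 addrC -nE => <-.
  by apply: eq_big => S; rewrite ?finset.sub0set // expr1n mulr1.
set N := \sum_(w | _ && nontrivial w) _.
have NE : N = \sum_(p : {set edge k} * {set {set vertex k}} |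
     [&& loop_config p.1, p.2 \subset loops p.1 & nontrivial p.1]) q ^+ #|p.2|.
  rewrite /N; under eq_bigr => w _ do rewrite colour.
  rewrite pair_big_dep; apply: eq_bigl => -[w S] /=.
  by rewrite -andbA; congr (_ && _); rewrite andbC.
apply: (@le_trans _ _ ((\sum_(w | loop_config w)
   \sum_(S : {set {set vertex k}} | (S \subset loops w) && avoidable w S) q ^+ #|S|) *+ 2)).
  rewrite -sumrMnl; apply: ler_sum => w _; rewrite {1}nE.
  apply: colouring_half => // S S' Sw S'w.
  have sub : loops w \subset components w.
    by apply/fintype.subsetP => A; exact: loop_is_component.
  by apply: avoidable_dual; rewrite ?(fintype.subset_trans Sw) ?(fintype.subset_trans S'w).
rewrite -[4%N]/(2 * 2)%N mulrnA; rewrite lerMn2r /= mulr2n.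
rewrite expand (bigID (fun p => nontrivial p.1)) /=; apply: lerD.
  rewrite NE [X in X <= _]big_mkcond [X in _ <= X]big_mkcond; apply: ler_sum => -[w S] _ /=.
  case: ifP => [/andP[/and3P[-> -> _] ->] //|_].
  by case: ifP => // _; apply: exprn_ge0; case/andP: q01.
rewrite NE; apply: le_trans (resampling_le _); last by case/andP: q01.
rewrite le_eqVlt; apply/orP; left; apply/eqP.
by apply: eq_bigl => -[w S] /=; rewrite -!andbA.
Qed.

End Conclusion.

Theorem theorem3 (R : realType) (n : R) (k : nat) (hn : 1 <= n <= 2)
    (hk : (1 <= k)%N) :
  1 / 4 <= loopO_prob n 1 [set w : {set edge k} | `[< has_noncontractible_loop R w >]].
Proof.
have n_gt0 : 0 < n by case/andP: hn => n1 _; apply: lt_le_trans n1.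
have weightE w : weight n 1 w = n ^+ #|loops w| :> R by rewrite /weight expr1n mul1r.
have Z_gt0 : 0 < partition_function k n 1.
  rewrite /partition_function (bigD1 finset.set0) /=.
    apply: ltr_pwDl; first by rewrite weightE exprn_gt0.
    by apply: sumr_ge0 => w _; rewrite weightE exprn_ge0 // ltW.
  apply/forallP => v; suff -> : degree finset.set0 v = 0%N by [].
  by apply/eqP; rewrite cards_eq0; apply/eqP/setP => e; rewrite !inE.
rewrite /loopO_prob -mulr_suml ler_pdivlMr // mul1r ler_pdivrMl ?ltr0n //.
rewrite mulr_natl /partition_function; under eq_bigr => w _ do rewrite weightE.
apply: le_trans (nontrivial_quarter hk hn) _; rewrite lerMn2r /=.
rewrite [X in X <= _]big_mkcond [X in _ <= X]big_mkcond; apply: ler_sum => w _.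
case: ifP => [/andP[evenw ntw]|_].
  rewrite inE evenw (asboolT (nontrivial_noncontractible R hk evenw ntw)).
  by rewrite weightE.
by case: ifP => // _; rewrite weightE exprn_ge0 // ltW.
Qed.
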